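(* Let $p,Q$ be real-valued measurable functions on the finite interval $\mathcal J=(a,b)$ with $1/p,\ Q/p,\ Q^2/p\in L_1(\mathcal J)$. Let $K$ be a contracting $2\times2$ complex matrix ($\|K\|\le1$), so that the boundary conditions $$(K-I)\Gamma_1y+i(K+I)\Gamma_2y=0$$ defining the operator $L_K$ (see the context) are dissipative. These boundary conditions are separated if and only if $$K=\begin{pmatrix}K_a&0\\0&K_b\end{pmatrix}$$ where $K_a,K_b\in\mathbb C$, $|K_a|\le1$ and $|K_b|\le1$.
   Context: Let $\mathcal J=(a,b)$ be a finite interval and $L_2=L_2(\mathcal J,\mathbb C)$; $p$ is finite and nonzero a.e. The formal expression $-(py')'+qy$ with $q=Q'$ (distributional derivative) is interpreted through the quasi-derivatives $$D^{[0]}y=y,\qquad D^{[1]}y=py'-Qy,\qquad D^{[2]}y=(D^{[1]}y)'+\frac Qp D^{[1]}y+\frac{Q^2}{p}y$$ as $l[y]:=-D^{[2]}y$. The maximal operator is $L_{\max}y=l[y]$ with $\operatorname{Dom}(L_{\max})=\{y\in L_2:\ y,D^{[1]}y\in AC([a,b],\mathbb C),\ D^{[2]}y\in L_2\}$. Define $\Gamma_1,\Gamma_2:\operatorname{Dom}(L_{\max})\to\mathbb C^2$ by $$\Gamma_1y=(D^{[1]}y(a),-D^{[1]}y(b)),\qquad \Gamma_2y=(y(a),y(b)).$$ For a linear operator $K$ on $\mathbb C^2$, $L_K$ denotes the restriction of $L_{\max}$ to the set of $y\in\operatorname{Dom}(L_{\max})$ satisfying $(K-I)\Gamma_1y+i(K+I)\Gamma_2y=0$.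 The norm $\|K\|$ is the operator norm for the standard Hermitian norm on $\mathbb C^2$. For a continuous function $f$ on $[a,b]$ and $c\in[a,b]$, $\mathbf{f_c}$ denotes the germ of $f$ at $c$ (within $[a,b]$). The boundary conditions defining an operator $L\subset L_{\max}$ are called separated if for arbitrary $y\in\operatorname{Dom}(L)$ and $g,h\in\operatorname{Dom}(L_{\max})$ with $\mathbf{g_a}=\mathbf{y_a}$, $\mathbf{g_b}=0$, $\mathbf{h_a}=0$, $\mathbf{h_b}=\mathbf{y_b}$ one has $g,h\in\operatorname{Dom}(L)$. *)

(* Defs.v *)
From HB Require Import structures.
From mathcomp Require Import all_boot all_order all_algebra.
From mathcomp Require Import all_classical all_reals all_analysis.
From mathcomp Require Import complex.

Set Implicit Arguments.
Unset Strict Implicit.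
Unset Printing Implicit Defensive.

Import Order.TTheory GRing.Theory Num.Theory.
Import numFieldNormedType.Exports.

Local Open Scope classical_set_scope.
Local Open Scope complex_scope.
Local Open Scope ring_scope.

Local Notation Re := complex.Re.
Local Notation Im := complex.Im.

(* The measure is the library's Lebesgue measure on the Borel sets of R.
   Lebesgue-measurable functions, and elements of L_1 and L_2, are taken modulo
   equality almost everywhere: a function is Lebesgue measurable if and only
   if it coincides almost everywhere with a Borel one. *)
Section function_spaces.
Context {R : realType}.
Local Notation mu := (@lebesgue_measure R).

Definition Lebesgue_measurable (D : set R) (f : R -> R) : Prop :=
  exists2 g : R -> R, measurable_fun D g & ae_eq mu D f g.

Definition in_L1 (D : set R) (f : R -> R) : Prop :=
  exists2 g : R -> R, mu.-integrable D (EFin \o g) & ae_eq mu D f g.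

Definition in_L2 (D : set R) (f : R -> R[i]) : Prop :=
  exists g : R -> R[i],
    [/\ measurable_fun D (fun x => Re (g x)),
        measurable_fun D (fun x => Im (g x)),
        (\int[mu]_(x in D) (Normc.normc (g x) ^+ 2)%:E < +oo)%E &
        ae_eq mu D f g].

Definition in_AC (a b : R) (f : R -> R[i]) : Prop :=
  forall e : R, 0 < e -> exists2 d : R, 0 < d &
    forall (n : nat) (s t : 'I_n -> R),
      (forall i, [/\ a <= s i, s i <= t i & t i <= b]) ->
      trivIset setT (fun i => `]s i, t i[%classic) ->
      \sum_(i < n) (t i - s i) < d ->
      \sum_(i < n) Normc.normc (f (t i) - f (s i)) < e.

(* Meaningful where the real and imaginary parts are derivable, hence almost
   everywhere on `]a, b[ when f is absolutely continuous on `[a, b]. *)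
Definition cderive (f : R -> R[i]) (x : R) : R[i] :=
  derive1 (fun t => Re (f t)) x +i* derive1 (fun t => Im (f t)) x.

Definition same_germ (a b c : R) (f g : R -> R[i]) : Prop :=
  \forall x \near within `[a, b] (nbhs c), f x = g x.

End function_spaces.

Section hermitian.
Context {R : realType}.

Definition hnorm n (v : 'cV[R[i]]_n) : R :=
  Num.sqrt (\sum_(i < n) Normc.normc (v i 0) ^+ 2).

Definition opnorm n (K : 'M[R[i]]_n) : R :=
  sup [set hnorm (K *m v) | v in [set v : 'cV[R[i]]_n | hnorm v <= 1]].

End hermitian.

Section sturm_liouville.
Context {R : realType}.
Variables (a b : R) (p Q : R -> R).
Local Notation mu := (@lebesgue_measure R).
Local Notation J := (`]a, b[%classic : set R).
Implicit Types y g h u : R -> R[i].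

Definition D1_formula y (x : R) : R[i] :=
  (p x)%:C * cderive y x - (Q x)%:C * y x.

(* The formula p y' - Q y only makes sense almost everywhere, whereas D1 y has
   to be evaluated at a and b; so D1 y is the absolutely continuous function
   that coincides almost everywhere with the formula, if there is one (it is
   then unique on `[a, b]), and the formula itself otherwise.  The default
   value matters: it makes in_AC a b (D1 y) fail when no absolutely continuous
   version exists. *)
Definition D1 y : R -> R[i] :=
  xget (D1_formula y) [set u | in_AC a b u /\ ae_eq mu J u (D1_formula y)].

Definition D2 y (x : R) : R[i] :=
  cderive (D1 y) x + (Q x / p x)%:C * D1 y x + (Q x ^+ 2 / p x)%:C * y x.

(* Elements of the domain are represented by functions on R of which only the
   values on `[a, b] matter. *)
Definition Dom_Lmax : set (R -> R[i]) :=
  [set y | [/\ in_L2 J y, in_AC a b y, in_AC a b (D1 y) & in_L2 J (D2 y)]].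

Definition Gamma1 y : 'cV[R[i]]_2 := \col_(k < 2) [:: D1 y a; - D1 y b]`_k.

Definition Gamma2 y : 'cV[R[i]]_2 := \col_(k < 2) [:: y a; y b]`_k.

Definition Dom_LK (K : 'M[R[i]]_2) : set (R -> R[i]) :=
  [set y | Dom_Lmax y /\
     (K - 1%:M) *m Gamma1 y + 'i%C *: ((K + 1%:M) *m Gamma2 y) = 0].

(* A restriction of Lmax : y |-> - D2 y is determined by its domain, here
   DomL. *)
Definition separated_bc (DomL : set (R -> R[i])) : Prop :=
  forall y g h, DomL y -> Dom_Lmax g -> Dom_Lmax h ->
    same_germ a b a g y -> same_germ a b b g (cst 0) ->
    same_germ a b a h (cst 0) -> same_germ a b b h y ->
    DomL g /\ DomL h.

End sturm_liouville.

(* Main.v *)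
Require Import Defs.
From HB Require Import structures.
From mathcomp Require Import all_boot all_order all_algebra.
From mathcomp Require Import all_classical all_reals all_analysis.
From mathcomp Require Import measurable_realfun complex ring lra.

Set Implicit Arguments.
Unset Strict Implicit.
Unset Printing Implicit Defensive.

Import Order.TTheory GRing.Theory Num.Theory.
Import numFieldNormedType.Exports.

Local Open Scope classical_set_scope.
Local Open Scope ring_scope.

(* In terms of u = y and z = D^[1] y the equation D^[2] y = f is the first order
   system u' = (Q/p) u + (1/p) z, z' = f - (Q^2/p) u - (Q/p) z with L_1
   coefficients, which is solved on short intervals by a contraction argument.
   The main point is that its boundary values are controllable: on a short
   interval ]c, d[ a bounded f drives any (u, z)(c) to any (u, z)(d).  By
   Lagrange's identity this reduces to the linear independence of the
   fundamental solutions as functions on ]c, d[, which holds because 1/p <> 0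
   almost everywhere.  Hence some y in Dom(L_max) has arbitrary prescribed values
   of Gamma_1 y and Gamma_2 y and splits as y = g + h with g = 0 near b and h = 0
   near a.  If the conditions are separated, g and h satisfy them as well, and
   for y with Gamma_1 y = -i (K + I) w and Gamma_2 y = (K - I) w this yields
   K_10 w_0 = K_01 w_1 = 0.  Conversely, for K diagonal each of the two conditions
   only involves the values at one end point, which depend on the germ alone. *)

(** * Primitives of integrable functions: absolute continuity and the product rule *)

Section primitive.
Context {R : realType}.
Local Notation mu := (@lebesgue_measure R).
Implicit Types (f g h : R -> R) (x y : R).

(** Integrability is over the whole line: coefficients given on an interval get extended by zero, so
    that no domain has to be carried along. *)
Definition L1 f := mu.-integrable setT (EFin \o f).

(** Integrating from minus infinity avoids a base point; to the left of the support of [f] the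
    primitive is 0, so initial values appear as additive constants. *)
Definition prim f x : R := (\int[mu]_(t in `]-oo, x]) f t)%R.

Lemma L1_measurable f : L1 f -> measurable_fun setT f.
Proof. by move=> /measurable_int/measurable_EFinP. Qed.

Lemma L1S D f : measurable D -> L1 f -> mu.-integrable D (EFin \o f).
Proof. by move=> mD; exact: integrableS. Qed.

Lemma L1_Rintegral D f : measurable D -> L1 f ->
  (\int[mu]_(x in D) (f x)%:E)%E = (\int[mu]_(x in D) f x)%:E.
Proof. by move=> mD f1; rewrite fineK//; exact: integrable_fin_num (L1S mD f1). Qed.

Lemma L1D f g : L1 f -> L1 g -> L1 (fun x => f x + g x).
Proof. by move=> f1 g1; apply: eq_integrable (integrableD _ f1 g1). Qed.

Lemma L1B f g : L1 f -> L1 g -> L1 (fun x => f x - g x).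
Proof. by move=> f1 g1; apply: eq_integrable (integrableB _ f1 g1). Qed.

Lemma L1Z (c : R) f : L1 f -> L1 (fun x => c * f x).
Proof. by move=> f1; apply: eq_integrable (integrableZl _ c f1). Qed.

Lemma L1_le f h : measurable_fun setT h -> (forall x, `|h x| <= `|f x|) ->
  L1 f -> L1 h.
Proof.
move=> mh hf; apply: le_integrable => //; first exact/measurable_EFinP.
by move=> x _; rewrite /= lee_fin.
Qed.

Lemma L1_bounded (C : R) h f : measurable_fun setT h ->
  (forall x, `|h x| <= C) -> L1 f -> L1 (fun x => f x * h x).
Proof.
move=> mh hC f1; apply: eq_integrable (integrableMl _ f1 mh _) => //.
by exists C; split=> [|M CM x _]; [exact: num_real|exact: le_trans (hC x) (ltW CM)].
Qed.

Lemma primD f g x : L1 f -> L1 g ->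
  prim (fun x => f x + g x) x = prim f x + prim g x.
Proof. by move=> f1 g1; rewrite /prim RintegralD//; exact: L1S. Qed.

Lemma primB f g x : L1 f -> L1 g ->
  prim (fun x => f x - g x) x = prim f x - prim g x.
Proof. by move=> f1 g1; rewrite /prim RintegralB//; exact: L1S. Qed.

Lemma primZ c f x : L1 f -> prim (fun x => c * f x) x = c * prim f x.
Proof. by move=> f1; rewrite /prim RintegralZl//; exact: L1S. Qed.

Lemma prim0 x : prim (fun=> 0) x = 0.
Proof. by rewrite /prim Rintegral_cst// mul0r. Qed.

Lemma eq_prim f g x : (forall t, t <= x -> f t = g t) -> prim f x = prim g x.
Proof.
by move=> fg; apply: eq_Rintegral => t; rewrite inE /= in_itv/= => /fg.
Qed.

Lemma prim_sub f x y : L1 f -> x <= y ->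
  prim f y - prim f x = (\int[mu]_(t in `]x, y]) f t)%R.
Proof.
by move=> f1 xy; rewrite /prim Rintegral_itvB//; exact: L1S.
Qed.

Lemma prim_sub_le f x y : L1 f -> x <= y ->
  `|prim f y - prim f x| <= (\int[mu]_(t in `]x, y]) `|f t|)%R.
Proof.
by move=> f1 xy; rewrite prim_sub// le_normr_Rintegral//; exact: L1S.
Qed.

Lemma le_Rintegral_subset A B f : measurable A -> measurable B -> A `<=` B ->
  L1 f -> (\int[mu]_(t in A) `|f t|)%R <= (\int[mu]_(t in B) `|f t|)%R.
Proof.
move=> mA mB AB f1; have nf : L1 (fun t => `|f t|) by exact: integrable_norm.
rewrite fine_le//; [exact: integrable_fin_num (L1S _ _)..|].
apply: ge0_subset_integral => //; exact: (measurable_int _ (L1S mB nf)).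
Qed.

Lemma prim_le f x : L1 f -> `|prim f x| <= (\int[mu]_t `|f t|)%R.
Proof.
move=> f1; apply: (@le_trans _ _ (\int[mu]_(t in `]-oo, x]) `|f t|)%R).
  by rewrite /prim le_normr_Rintegral//; exact: L1S.
exact: le_Rintegral_subset.
Qed.

Lemma Rintegral_bigsetU (I : eqType) (F : I -> set R) f (r : seq I) :
  (forall i, measurable (F i)) -> uniq r -> trivIset [set` r] F -> L1 f ->
  (\int[mu]_(t in \big[setU/set0]_(i <- r) F i) f t)%R =
  \sum_(i <- r) (\int[mu]_(t in F i) f t)%R.
Proof.
move=> mF ur tF f1; apply: EFin_inj.
have mU : measurable (\big[setU/set0]_(i <- r) F i).
  by apply: bigsetU_measurable.
rewrite -sumEFin -L1_Rintegral//.
rewrite integral_bigsetU_EFin//; last first.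
  exact: measurable_int (L1S mU f1).
by apply: eq_bigr => i _; rewrite -L1_Rintegral//; exact: mF.
Qed.

(** The integral of [|f|] over a set of small measure is small; this is applied to the union of the
    intervals. *)
Lemma prim_AC f : L1 f -> forall e, 0 < e -> exists2 d, 0 < d &
  forall n (s t : 'I_n -> R), (forall i, s i <= t i) ->
    trivIset setT (fun i => `]s i, t i[%classic) ->
    \sum_(i < n) (t i - s i) < d ->
    \sum_(i < n) `|prim f (t i) - prim f (s i)| < e.
Proof.
move=> f1 e e0; have [d [d0 Hd]] := integral_normr_continuous f1 e0.
exists d => // n s t st tI std.
have nf : L1 (fun t => `|f t|) by exact: integrable_norm.
pose A := \big[setU/set0]_(i < n) `]s i, t i[%classic.
have mA : measurable A by apply: bigsetU_measurable.
have muA : mu A = (\sum_(i < n) (t i - s i))%:E.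
  rewrite /A measure_bigsetU_ord//= -sumEFin; apply: eq_bigr => i _.
  rewrite lebesgue_measure_itv/= lte_fin; case: ltP => //.
  by move=> tsi; rewrite (@le_anti _ _ (s i) (t i)) ?tsi ?st// subrr.
have Ad : (mu A < d%:E)%E by rewrite muA lte_fin.
apply: le_lt_trans (Hd A mA Ad).
rewrite /A Rintegral_bigsetU//; last 2 first.
- by rewrite /= index_enum_uniq.
- by move: tI; apply: sub_trivIset.
apply: ler_sum => i _; apply: (le_trans (prim_sub_le _ _)) => //.
(* The increments live on half-open intervals, while only the open ones are disjoint; the end points
   form a null set. *)
by rewrite -Rintegral_itv_bndo_bndc//; exact: L1S.
Qed.

Lemma prim_continuous f : L1 f -> continuous (prim f).
Proof.
move=> f1 x; apply/cvgrPdist_lt => e e0.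
have [d d0 Hd] := prim_AC f1 e0.
have {}Hd s t : s <= t -> t - s < d -> `|prim f t - prim f s| < e.
  move=> st std; have := Hd 1%N (fun=> s) (fun=> t) (fun=> st).
  rewrite !big_ord1; apply => //.
  by move=> i j _ _ _; rewrite (ord1 i) (ord1 j).
near=> y; have xyd : `|x - y| < d.
  by near: y; apply: cvgr_dist_lt => //; exact: cvg_id.
have [xy|yx] := leP x y.
  by rewrite distrC Hd// -(ger0_norm (_ : 0 <= y - x)) ?subr_ge0// distrC.
by rewrite Hd ?ltW// (le_lt_trans (ler_norm _)).
Unshelve. all: by end_near. Qed.

Lemma prim_measurable f : L1 f -> measurable_fun setT (prim f).
Proof. by move=> f1; apply: continuous_measurable_fun; exact: prim_continuous. Qed.

Lemma prim_derive f : L1 f ->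
  {ae mu, forall x, derivable (prim f) x 1 /\ derive1 (prim f) x = f x}.
Proof.
move=> f1; apply: FTC1Ny => [y|]; first exact: L1S.
by apply: open_integrable_locally => //; exact: openT.
Qed.

Lemma L1_indic A f : measurable A -> L1 f -> L1 (fun t => f t * \1_A t).
Proof.
move=> mA; apply: (@L1_bounded 1); first exact: measurable_indic.
by move=> x; rewrite indicE; case: (_ \in _); rewrite ?normr1 ?normr0.
Qed.

Lemma Rintegral_indic A f :
  (\int[mu]_t (f t * \1_A t))%R = (\int[mu]_(t in A) f t)%R.
Proof.
rewrite [RHS]Rintegral_mkcond; apply: eq_Rintegral => t _.
by rewrite patchE indicE; case: (_ \in _); rewrite ?mulr1 ?mulr0.
Qed.

Lemma Rintegral_ray f x : L1 f ->
  (\int[mu]_(t in `[x, +oo[) f t)%R = (\int[mu]_t f t)%R - prim f x.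
Proof.
move=> f1; rewrite -Rintegral_itv_obnd_cbnd; last exact: L1S.
by rewrite -set_itvNyy -(Rintegral_itvB (a := -oo%O))//; exact: L1S.
Qed.

(** Domination by a product of two integrable functions gives integrability on the plane by Tonelli,
    after which Fubini applies. *)
Lemma Rintegral_fubini (h : R -> R -> R) :
  measurable_fun setT (fun z : R * R => h z.1 z.2) ->
  (exists u v : R -> R, [/\ L1 u, L1 v & forall x y, `|h x y| <= `|u x * v y|]) ->
  (\int[mu]_x (\int[mu]_y h x y))%R = (\int[mu]_y (\int[mu]_x h x y))%R.
Proof.
move=> mh [u [v [u1 v1 huv]]].
have mu_ := L1_measurable u1; have mv := L1_measurable v1.
have hx x : L1 (h x).
  apply: (L1_le _ (huv x)); last exact: L1Z.
  rewrite (_ : h x = (fun z => h z.1 z.2) \o pair x)//.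
  by apply: measurableT_comp => //; exact: measurable_pair1.
have hy y : L1 (h^~ y).
  have huvC x : `|h x y| <= `|v y * u x| by rewrite mulrC.
  apply: (L1_le _ huvC); last exact: L1Z.
  rewrite (_ : h^~ y = (fun z => h z.1 z.2) \o (fun x => (x, y)))//.
  by apply: measurableT_comp => //; exact: measurable_pair2.
have H1 : (mu \x mu)%E.-integrable setT (fun z : R * R => (h z.1 z.2)%:E).
  apply/integrable12ltyP; first exact/measurable_EFinP.
  apply: (@le_lt_trans _ _ (\int[mu]_x \int[mu]_y (`|u x| * `|v y|)%:E)%E).
    have mh' : measurable_fun setT (fun z : R * R => (`|h z.1 z.2|)%:E).
      by apply/measurable_EFinP; apply: measurableT_comp.
    have muv : measurable_fun setT (fun z : R * R => (`|u z.1| * `|v z.2|)%:E).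
      apply/measurable_EFinP; apply: measurable_funM.
        by do 2 apply: measurableT_comp => //; exact: measurable_fst.
      by do 2 apply: measurableT_comp => //; exact: measurable_snd.
    apply: ge0_le_integral => //=.
    - by move=> x _; exact: integral_ge0.
    - by apply: (@measurable_fun_fubini_tonelli_F _ _ _ _ _ mu _ mh') => z; rewrite lee_fin.
    - apply: (@measurable_fun_fubini_tonelli_F _ _ _ _ _ mu _ muv) => z.
      by rewrite lee_fin mulr_ge0.
    - move=> x _; apply: ge0_le_integral => //=.
      + exact: (measurableT_comp mh' (measurable_pair1 x)).
      + exact: (measurableT_comp muv (measurable_pair1 x)).
      + by move=> y _; rewrite lee_fin -normrM.
  have v1' : mu.-integrable setT (EFin \o (fun y => `|v y|)) by exact: integrable_norm.
  have u1' : mu.-integrable setT (EFin \o (fun y => `|u y|)) by exact: integrable_norm.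
  under eq_integral => x _.
    under eq_integral do rewrite EFinM.
    rewrite integralZl//.
    over.
  rewrite -(fineK (integrable_fin_num measurableT v1')) integralZr//.
  by rewrite ltey_eq fin_numM//; exact: integrable_fin_num u1'.
have fin x : (\int[mu]_y (h x y)%:E)%E = ((\int[mu]_y h x y)%R)%:E.
  exact: L1_Rintegral.
have fin' y : (\int[mu]_x (h x y)%:E)%E = ((\int[mu]_x h x y)%R)%:E.
  exact: L1_Rintegral.
have := Fubini H1 => /= E.
rewrite /Rintegral; congr fine.
under eq_integral do rewrite -fin.
by rewrite E; apply: eq_integral => y _; rewrite fin'.
Qed.

Lemma L1_mul_prim f g : L1 f -> L1 g -> L1 (fun x => f x * prim g x).
Proof.
move=> f1 g1; apply: L1_bounded f1 => [|x]; first exact: prim_measurable.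
exact: prim_le.
Qed.

(** Integration by parts over the line: the left side is the integral of [f x * g y] over the
    half-plane [y <= x], and exchanging the integrals leaves the integral of [f] over the ray [[y,
    +oo[], that is its total integral minus [prim f y]. *)
Lemma Rintegral_mul_prim f g : L1 f -> L1 g ->
  (\int[mu]_x (f x * prim g x))%R =
  (\int[mu]_x f x)%R * (\int[mu]_x g x)%R - (\int[mu]_x (g x * prim f x))%R.
Proof.
move=> f1 g1.
have pI x y : \1_`]-oo, x] y = \1_`[y, +oo[ x :> R.
  by rewrite !indicE !mem_setE !in_itv/= andbT.
have e1 x : f x * prim g x = (\int[mu]_y (f x * g y * \1_`]-oo, x] y))%R.
  by rewrite Rintegral_indic RintegralZl//; exact: L1S.
have e2 y : (\int[mu]_x (f x * g y * \1_`]-oo, x] y))%R =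
    (\int[mu]_x f x)%R * g y - g y * prim f y.
  transitivity (\int[mu]_x (g y * (f x * \1_`[y, +oo[ x)))%R.
    by apply: eq_Rintegral => x _; rewrite pI mulrCA mulrA.
  rewrite RintegralZl//; last exact: L1_indic.
  by rewrite Rintegral_indic Rintegral_ray// mulrBr mulrC.
under eq_Rintegral do rewrite e1.
rewrite Rintegral_fubini; last 2 first.
- apply: measurable_funM.
    apply: measurable_funM.
      exact: (measurableT_comp (L1_measurable f1) measurable_fst).
    exact: (measurableT_comp (L1_measurable g1) measurable_snd).
  have mS : measurable [set z : R * R | z.2 <= z.1].
    rewrite -[X in measurable X]setTI.
    exact: (measurable_fun_le measurableT measurable_snd measurable_fst).
  rewrite (_ : (fun z : R * R => _) = \1_[set z : R * R | z.2 <= z.1]).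
    exact: measurable_indic.
  by apply/funext => z; rewrite !indicE !mem_setE in_itv.
- exists f, g; split=> // x y; rewrite normrM ler_piMr// indicE.
  by case: (_ \in _); rewrite ?normr1 ?normr0.
under eq_Rintegral do rewrite e2.
rewrite RintegralB//; [|exact: L1Z|exact: L1_mul_prim].
by rewrite RintegralZl.
Qed.

(** The product rule in integrated form. Cutting [f] and [g] off at [x] turns [prim] at [x] into an
    integral over the line and does not change the primitives to the left of [x]. *)
Lemma prim_mul f g x : L1 f -> L1 g ->
  prim f x * prim g x = prim (fun t => f t * prim g t + g t * prim f t) x.
Proof.
move=> f1 g1.
have mx : measurable (`]-oo, x]%classic : set R) by [].
pose fx t := f t * \1_`]-oo, x] t; pose gx t := g t * \1_`]-oo, x] t.
have fx1 : L1 fx by exact: L1_indic.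
have gx1 : L1 gx by exact: L1_indic.
have px h t : t <= x -> prim (fun t => h t * \1_`]-oo, x] t) t = prim h t.
  move=> tx; apply: eq_prim => s st.
  by rewrite indicE mem_setE in_itv/= (le_trans st tx) mulr1.
have Ix h : L1 h -> (\int[mu]_t (h t * \1_`]-oo, x] t))%R = prim h x.
  by move=> h1; rewrite Rintegral_indic.
have := Rintegral_mul_prim fx1 gx1.
rewrite !Ix// => /esym/eqP; rewrite subr_eq => /eqP ->.
have Ex h k : L1 h -> L1 k ->
    (\int[mu]_t (h t * \1_`]-oo, x] t * prim (fun t => k t * \1_`]-oo, x] t) t))%R
    = prim (fun t => h t * prim k t) x.
  move=> h1 k1; rewrite -Ix; last exact: L1_mul_prim.
  apply: eq_Rintegral => t _; rewrite indicE mem_setE in_itv/=.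
  by case: leP => [/px ->|_]; rewrite ?mulr1// !mulr0 mul0r.
by rewrite !Ex// primD//; exact: L1_mul_prim.
Qed.

End primitive.

(** * A fixed point theorem for bounded families of functions *)

Section contraction.
Context {R : realType}.
Implicit Types (I T : Type) (C : R).

Lemma cvg_halfpow C : C / 2 ^+ n @[n --> \oo] --> (0 : R).
Proof.
rewrite -(mulr0 C); under eq_fun do rewrite -exprVn.
by apply: cvgMr; apply: cvg_expr; rewrite ger0_norm ?invr_ge0// invf_lt1 ?ltr1n.
Qed.

Lemma eq0_halfpow C (x : R) : (forall n, `|x| <= C / 2 ^+ n) -> x = 0.
Proof.
move=> xC; apply/eqP; rewrite -normr_le0.
have c := @cvg_halfpow C; rewrite -(cvg_lim _ c)//.
by apply: limr_ge; [apply/cvg_ex; exists 0|exact: nearW].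
Qed.

(** The tail of the geometric series from index [n] on sums to [2 * C / 2 ^+ n]. *)
Lemma cauchy_halfpow C (w : nat -> R) :
  (forall n, `|w n.+1 - w n| <= C / 2 ^+ n) ->
  exists l, w n @[n --> \oo] --> l /\ forall n, `|l - w n| <= 2 * C / 2 ^+ n.
Proof.
move=> wC.
have twoC : 2 * C = C * 2 by rewrite mulrC.
have far m n : `|w (n + m)%N - w n| <= 2 * C / 2 ^+ n.
  elim: m n => [|m IH] n.
    rewrite addn0 subrr normr0 -mulrA mulr_ge0//.
    exact: le_trans (wC n).
  rewrite addnS -addSn (le_trans (ler_distD (w n.+1) _ _))//.
  apply: (le_trans (lerD (IH n.+1) (wC n))).
  by rewrite twoC exprS invfM mulrA mulfK// mulrAC mulr_natr mulr2n.
have /cvg_ex[l wl] : cvg (w n @[n --> \oo]).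
  apply: R_complete; apply: cauchy_exP => e e0.
  have [N _ /(_ N (leqnn N)) NC] : \forall n \near \oo, `|2 * C / 2 ^+ n| < e.
    by have /cvgr0_norm_lt := @cvg_halfpow (2 * C); apply.
  exists (w N); exists N => // n /= Nn.
  rewrite /ball/= distrC -(subnKC Nn) (le_lt_trans (far _ _))//.
  by rewrite (le_lt_trans (ler_norm _))//.
exists l; split=> // n; apply/ler_addgt0Pr => e e0.
have [m mn lm] : exists2 m, (n <= m)%N & `|l - w m| < e.
  have [N _ NC] : \forall n \near \oo, `|l - w n| < e by apply: cvgr_dist_lt.
  by exists (maxn N n); [exact: leq_maxr|apply: NC; exact: leq_maxl].
rewrite (le_trans (ler_distD (w m) _ _))// addrC lerD//; last exact: ltW.
by rewrite -(subnKC mn).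
Qed.

(** Picard iteration from zero: successive differences are at most [M / 2 ^+ n], so the iterates
    stay below [2 * M] and converge with a uniform geometric error. [D] is a property that survives
    pointwise limits, such as measurability, and [I] indexes the components of a vector-valued
    function. *)
Lemma contraction_fixpoint I T (D : set (I -> T -> R))
    (A : (I -> T -> R) -> I -> T -> R) (M : R) :
  D (fun _ _ => 0) ->
  (forall v (B : R), D v -> (forall i t, `|v i t| <= B) -> D (A v)) ->
  (forall v w (B C : R), D v -> D w -> (forall i t, `|v i t| <= C) ->
    (forall i t, `|w i t| <= C) -> (forall i t, `|v i t - w i t| <= B) ->
    forall i t, `|A v i t - A w i t| <= B / 2) ->
  (forall i t, `|A (fun _ _ => 0) i t| <= M) ->
  (forall (w : nat -> I -> T -> R) v, (forall n, D (w n)) ->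
    (forall i t, w n i t @[n --> \oo] --> v i t) -> D v) ->
  exists v, [/\ D v, forall i t, `|v i t| <= 2 * M &
    forall i t, A v i t = v i t].
Proof.
move=> D0 DA contr AM Dlim.
pose w n := iter n A (fun _ _ => 0).
have z2M (i : I) (x : T) : `|0 : R| <= 2 * M.
  by rewrite normr0 mulr_ge0//; exact: le_trans (AM i x).
have wM n : D (w n) /\ forall i x, `|w n i x| <= 2 * M.
  elim: n => [|n [Dn nM]]; first by [].
  split.
  - exact: DA Dn nM.
  - move=> i x /=.
    have := contr _ _ (2 * M) (2 * M) Dn D0 nM z2M _ i x.
    rewrite mulrAC divff// mul1r => AwM.
    rewrite -[A (w n) i x](subrK (A (fun _ _ => 0) i x)) (le_trans (ler_normD _ _))//.
    rewrite mulr_natl mulr2n lerD// AwM// => j y.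
    by rewrite subr0.
have wC n i x : `|w n.+1 i x - w n i x| <= M / 2 ^+ n.
  elim: n i x => [|n IH] i x; first by rewrite /w/= subr0 expr0 divr1.
  rewrite exprSr invfM mulrA.
  have [[Dn nM] [DSn SnM]] := (wM n, wM n.+1).
  exact: (contr _ _ _ (2 * M)).
have wl (ix : I * T) := cauchy_halfpow (fun n => wC n ix.1 ix.2).
have [l lP] := choice wl; pose v i x : R := l (i, x).
have vP i x := lP (i, x).
have Dv : D v by apply: (Dlim w) => [n|i x]; [exact: (wM n).1|exact: (vP i x).1].
have v2M i x : `|v i x| <= 2 * M.
  by have := (vP i x).2 0%N; rewrite expr0 divr1 /w/= subr0; exact.
exists v; split=> // i x.
apply/eqP; rewrite -subr_eq0; apply/eqP/(@eq0_halfpow (2 * M)) => n.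
(* The residual [A v - v] is split at [w n.+1 = A (w n)]; each half is at most [M / 2 ^+ n]. *)
rewrite -(subrKA (w n.+1 i x)) (le_trans (ler_normD _ _))//.
have e1 := contr _ _ _ _ Dv (wM n).1 v2M (wM n).2 (fun i x => (vP i x).2 n) i x.
have e2 := (vP i x).2 n.+1; rewrite distrC in e2.
apply: (le_trans (lerD e1 e2)).
rewrite exprS invfM.
by rewrite le_eqVlt; apply/orP; left; apply/eqP; field; rewrite expf_neq0.
Qed.

End contraction.

(** * Solvability of the first order system when the kernels are small *)

Section volterra.
Context {R : realType}.
Local Notation mu := (@lebesgue_measure R).
Implicit Types (f g h k : R -> R) (x y : R).

Definition mbounded f := measurable_fun setT f /\ exists C : R, forall x, `|f x| <= C.

Lemma mbounded_cst c : mbounded (cst c).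
Proof. by split=> //; exists `|c|. Qed.

Lemma mboundedD f g : mbounded f -> mbounded g -> mbounded (fun x => f x + g x).
Proof.
move=> [mf [C fC]] [mg [B gB]]; split; first exact: measurable_funD.
by exists (C + B) => x; rewrite (le_trans (ler_normD _ _))// lerD.
Qed.

Lemma mboundedM f g : mbounded f -> mbounded g -> mbounded (fun x => f x * g x).
Proof.
move=> [mf [C fC]] [mg [B gB]]; split; first exact: measurable_funM.
by exists (C * B) => x; rewrite normrM ler_pM.
Qed.

Lemma mbounded_prim f : L1 f -> mbounded (prim f).
Proof. by move=> f1; split; [exact: prim_measurable|eexists => x; exact: prim_le]. Qed.

Lemma L1M f g : L1 f -> mbounded g -> L1 (fun x => f x * g x).
Proof. by move=> f1 [mg [C gC]]; exact: L1_bounded gC f1. Qed.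

Lemma prim_mul_le k h (B : R) x : L1 k -> measurable_fun setT h ->
  (forall x, `|h x| <= B) ->
  `|prim (fun t => k t * h t) x| <= B * (\int[mu]_t `|k t|)%R.
Proof.
move=> k1 mh hB; have kh : L1 (fun t => k t * h t) by exact: L1_bounded hB k1.
have nk : L1 (fun t => `|k t|) by exact: integrable_norm.
apply: (le_trans (prim_le _ kh)); rewrite -RintegralZl//.
apply: le_Rintegral => //; [exact: integrable_norm|exact: L1Z|].
by move=> t _; rewrite normrM mulrC ler_wpM2r.
Qed.

(** Each equation contains two kernels of integral at most 1/4, so the integral operator halves
    sup-distances and the fixed point theorem applies. *)
Lemma volterra k1 k2 k3 F G : L1 k1 -> L1 k2 -> L1 k3 ->
  (\int[mu]_t `|k1 t|)%R <= 4^-1 -> (\int[mu]_t `|k2 t|)%R <= 4^-1 ->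
  (\int[mu]_t `|k3 t|)%R <= 4^-1 -> mbounded F -> mbounded G ->
  exists u z, [/\ mbounded u, mbounded z,
    forall x, u x = F x + prim (fun t => k2 t * u t + k1 t * z t) x &
    forall x, z x = G x - prim (fun t => k3 t * u t + k2 t * z t) x].
Proof.
move=> k1L k2L k3L k1M k2M k3M [mF [CF FC]] [mG [CG GC]].
pose D := [set v : bool -> R -> R | forall i, measurable_fun setT (v i)].
(* The index [true] stands for [u] and [false] for [z]. *)
pose A (v : bool -> R -> R) i x :=
  if i then F x + prim (fun t => k2 t * v true t + k1 t * v false t) x
  else G x - prim (fun t => k3 t * v true t + k2 t * v false t) x.
have key ka kb (v w : bool -> R -> R) (B : R) x : L1 ka -> L1 kb ->
    (\int[mu]_t `|ka t|)%R <= 4^-1 -> (\int[mu]_t `|kb t|)%R <= 4^-1 ->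
    D v -> D w -> (forall i, mbounded (v i)) -> (forall i, mbounded (w i)) ->
    (forall i t, `|v i t - w i t| <= B) ->
    `|prim (fun t => ka t * v true t + kb t * v false t) x -
      prim (fun t => ka t * w true t + kb t * w false t) x| <= B / 2.
  move=> kaL kbL kaM kbM Dv Dw bv bw vw.
  have B0 : 0 <= B by exact: le_trans (vw true 0).
  have mb i : mbounded (fun t => v i t - w i t).
    by split; [exact: measurable_funB|exists B].
  have -> : prim (fun t => ka t * v true t + kb t * v false t) x -
      prim (fun t => ka t * w true t + kb t * w false t) x =
      prim (fun t => ka t * (v true t - w true t)) x +
      prim (fun t => kb t * (v false t - w false t)) x.
    have L q : D q -> (forall i, mbounded (q i)) ->
        L1 (fun t => ka t * q true t + kb t * q false t).
      by move=> Dq bq; apply: L1D; exact: L1M.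
    rewrite -primB; [|exact: L|exact: L].
    rewrite -primD; [|exact: L1M|exact: L1M].
    by apply: eq_prim => t _; ring.
  rewrite (le_trans (ler_normD _ _))// [B]splitr -mulrDr.
  have kk k i : L1 k -> (\int[mu]_t `|k t|)%R <= 4^-1 ->
      `|prim (fun t => k t * (v i t - w i t)) x| <= B / 4.
    move=> kL kM; apply: le_trans (prim_mul_le x kL (mb i).1 (vw i)) _.
    by rewrite ler_wpM2l.
  have := lerD (kk _ true kaL kaM) (kk _ false kbL kbM).
  by move/le_trans; apply; lra.
have [|v B Dv vB|v w B C Dv Dw vC wC vw|i x|w v Dw wv|v [Dv vM vE]] :=
    @contraction_fixpoint R bool R D A (Num.max CF CG).
- by [].
- have mb i : mbounded (v i) by split=> //; exists B.
  have L ka kb : L1 ka -> L1 kb -> L1 (fun t => ka t * v true t + kb t * v false t).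
    by move=> kaL kbL; apply: L1D; exact: L1M.
  case; [apply: measurable_funD|apply: measurable_funB] => //;
    by apply: prim_measurable; exact: L.
- have bv i : mbounded (v i) by split=> //; exists C.
  have bw i : mbounded (w i) by split=> //; exists C.
  case=> x; rewrite /A /= opprD addrACA subrr add0r; first exact: key.
  by rewrite -opprD normrN; exact: key.
- rewrite /A; have A0 ka kb : prim (fun t : R => ka t * 0 + kb t * 0) x = 0.
    by under eq_fun do rewrite !mulr0 addr0; exact: prim0.
  by rewrite le_max; case: i; rewrite A0 ?addr0 ?subr0 ?FC ?GC ?orbT.
- by move=> i; apply: (measurable_fun_cvg (fun n => Dw n i)) => x _; exact: wv.
have mb i : mbounded (v i) by split=> //; exists (2 * Num.max CF CG).
exists (v true), (v false); split=> // x; by rewrite -[LHS]vE.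
Qed.

End volterra.

(** * From almost everywhere to everywhere on intervals *)

Section almost_everywhere.
Context {R : realType}.
Local Notation mu := (@lebesgue_measure R).

Lemma ae_itv_ex (c d : R) (P : R -> Prop) : c < d ->
  {ae mu, forall x, `]c, d[%classic x -> P x} -> exists2 x, `]c, d[%classic x & P x.
Proof.
move=> cd [N [mN N0 PN]]; apply: contrapT => /forall2NP noP.
have : (mu `]c, d[%classic <= mu N)%E.
  apply: le_measure; rewrite ?inE// => x cdx; apply: PN => /(_ cdx) Px.
  by have [] := noP x.
by rewrite N0 lebesgue_measure_itv/= lte_fin cd -EFinD lee_fin leNgt subr_gt0 cd.
Qed.

(** A nonzero value would persist on a whole interval around the point, and an interval is not a
    null set. *)
Lemma ae_eq_continuous (c d : R) (f : R -> R) :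
  {in `]c, d[, continuous f} ->
  {ae mu, forall x, `]c, d[%classic x -> f x = 0} ->
  forall x, x \in `]c, d[ -> f x = 0.
Proof.
move=> cf f0 x xcd; apply/eqP/negPn/negP => fx0.
have : \forall y \near x, f y != 0 by have /cvgr_neq0 := cf x xcd; exact.
have : \forall y \near x, y \in `]c, d[ by apply: near_in_itvoo.
move=> [e1 /= e10 He1] [e2 /= e20 He2].
pose e := Num.min e1 e2; have e0 : 0 < e by rewrite lt_min e10 e20.
have [||y] := @ae_itv_ex (x - e) (x + e) (fun y => y \in `]c, d[ -> f y = 0).
- by rewrite ltrBlDr -addrA ltrDl addr_gt0.
- have F := ae_filter_ringOfSetsType mu.
  by apply: filterS f0 => y /= + _ ycd; apply.
rewrite /= in_itv/= -ltr_distlC lt_min => /andP[y1 y2] fy.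
by have := He2 y y2; rewrite fy ?eqxx//; exact: He1.
Qed.

Lemma near_eq_derive1 (f g : R -> R) x : (\forall y \near x, f y = g y) ->
  derive1 f x = derive1 g x.
Proof. by move=> fg; rewrite !derive1E; apply: near_eq_derive => //; exact: oner_neq0. Qed.

End almost_everywhere.

(** * Solutions of the system on a short interval and their controllability *)

Section control.
Context {R : realType}.
Local Notation mu := (@lebesgue_measure R).
Implicit Types (f g h k u z : R -> R) (x y s t : R).

Definition supported c d f := forall x, x \notin `]c, d[ -> f x = 0.

Lemma L1_supported c d f : mbounded f -> supported c d f -> L1 f.
Proof.
move=> mf fS; have : L1 (\1_`]c, d[%classic : R -> R).
  exact: integrable_indic_itv.
move/L1M => /(_ f mf); apply: eq_integrable => // x _ /=; rewrite indicE.
have [|xcd] := boolP (x \in _); first by rewrite mul1r.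
by rewrite mul0r fS//; move: xcd; apply: contra => xcd; apply: mem_set.
Qed.

Lemma prim_supported_le c d f x : supported c d f -> x <= c -> prim f x = 0.
Proof.
move=> f0 xc; rewrite -(prim0 x); apply: eq_prim => t tx.
by rewrite f0// in_itv/= ltNge (le_trans tx xc).
Qed.

Lemma prim_supported_ge c d f x : L1 f -> supported c d f -> d <= x ->
  prim f x = prim f d.
Proof.
move=> f1 f0 dx; apply/eqP; rewrite -subr_eq0 prim_sub//; apply/eqP.
transitivity (\int[mu]_(t in `]d, x]) (0 : R))%R; last first.
  by rewrite Rintegral_cst// mul0r.
apply: eq_Rintegral => t; rewrite inE /= in_itv/= => /andP[dt _].
by rewrite f0// in_itv/= (ltNge t) (ltW dt) andbF.
Qed.

(** The product rule for functions given by an initial value and a derivative, the form in which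
    solutions occur. *)
Lemma prim_cst_mul f g (al be : R) x : L1 f -> L1 g ->
  (al + prim f x) * (be + prim g x) =
  al * be + prim (fun t => f t * (be + prim g t) + g t * (al + prim f t)) x.
Proof.
move=> f1 g1.
have -> : prim (fun t => f t * (be + prim g t) + g t * (al + prim f t)) x =
   prim (fun t => f t * prim g t + g t * prim f t) x +
   prim (fun t => be * f t + al * g t) x.
  rewrite -primD; last 2 first.
  - by apply: L1D; exact: L1_mul_prim.
  - by apply: L1D; exact: L1Z.
  by apply: eq_prim => t _; ring.
rewrite -prim_mul// primD; [|exact: L1Z|exact: L1Z].
by rewrite !primZ//; ring.
Qed.

Section kernels.
Variables (k1 k2 k3 : R -> R).
Hypotheses (k1L : L1 k1) (k2L : L1 k2) (k3L : L1 k3).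

(* For [k1 = 1 / p], [k2 = Q / p], [k3 = Q ^+ 2 / p] this is the integrated form
   of [D1 u = z] and [D2 u = f], with [u] and [z] equal to [al] and [be] at the
   left of the support of the kernels and of [f]. *)
Definition solution (al be : R) f u z :=
  [/\ mbounded u, mbounded z,
    forall x, u x = al + prim (fun t => k2 t * u t + k1 t * z t) x &
    forall x, z x = be + prim (fun t => f t - (k3 t * u t + k2 t * z t)) x].

Lemma solution_lin (a b al be al' be' : R) f u z f' u' z' : L1 f -> L1 f' ->
  solution al be f u z -> solution al' be' f' u' z' ->
  solution (a * al + b * al') (a * be + b * be')
    (fun t => a * f t + b * f' t)
    (fun t => a * u t + b * u' t) (fun t => a * z t + b * z' t).
Proof.
move=> fL fL' [mu_ mz uE zE] [mu' mz' uE' zE'].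
have mb v v' : mbounded v -> mbounded v' -> mbounded (fun t => a * v t + b * v' t).
  by move=> mv mv'; apply: mboundedD; apply: mboundedM => //; exact: mbounded_cst.
have L v w : mbounded v -> mbounded w -> L1 (fun t => k2 t * v t + k1 t * w t).
  by move=> mv mw; apply: L1D; exact: L1M.
have L' g v w : L1 g -> mbounded v -> mbounded w ->
    L1 (fun t => g t - (k3 t * v t + k2 t * w t)).
  by move=> gL mv mw; apply: L1B => //; apply: L1D; exact: L1M.
split; [exact: mb|exact: mb| |] => x.
- rewrite uE uE' !mulrDr -!primZ; [|exact: L..].
  rewrite addrACA -primD; [|exact/L1Z/L..].
  by congr (_ + _); apply: eq_prim => t _; ring.
- rewrite zE zE' !mulrDr -!primZ; [|exact: L'..].
  rewrite addrACA -primD; [|exact/L1Z/L'..].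
  by congr (_ + _); apply: eq_prim => t _; ring.
Qed.

(* The cross terms cancel because the system is formally self-adjoint. *)
Lemma lagrange (al be al' be' : R) f u z f' u' z' x : L1 f -> L1 f' ->
  solution al be f u z -> solution al' be' f' u' z' ->
  u x * z' x - z x * u' x =
  al * be' - be * al' + prim (fun t => u t * f' t - u' t * f t) x.
Proof.
move=> fL fL' [mu_ mz uE zE] [mu' mz' uE' zE'].
have L v w : mbounded v -> mbounded w -> L1 (fun t => k2 t * v t + k1 t * w t).
  by move=> mv mw; apply: L1D; exact: L1M.
have L' g v w : L1 g -> mbounded v -> mbounded w ->
    L1 (fun t => g t - (k3 t * v t + k2 t * w t)).
  by move=> gL mv mw; apply: L1B => //; apply: L1D; exact: L1M.
have key al1 be1 f1 u1 z1 al2 be2 f2 u2 z2 : L1 f1 -> L1 f2 ->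
    solution al1 be1 f1 u1 z1 -> solution al2 be2 f2 u2 z2 ->
    u1 x * z2 x = al1 * be2 + prim (fun t =>
      (k2 t * u1 t + k1 t * z1 t) * z2 t +
      (f2 t - (k3 t * u2 t + k2 t * z2 t)) * u1 t) x.
  move=> f1L f2L [mu1 mz1 uE1 zE1] [mu2 mz2 uE2 zE2].
  rewrite uE1 zE2 prim_cst_mul; [|exact: L|exact: L'].
  congr (_ + _); apply: eq_prim => t _.
  by rewrite -zE2 -uE1.
have S : solution al be f u z by [].
have S' : solution al' be' f' u' z' by [].
rewrite (key _ _ _ _ _ _ _ _ _ _ fL fL' S S').
rewrite [z x * _]mulrC (key _ _ _ _ _ _ _ _ _ _ fL' fL S' S).
rewrite opprD addrACA -primB.
- congr (_ + _); first by rewrite mulrC [be * _]mulrC.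
  by apply: eq_prim => t _; ring.
- by apply: L1D; apply: L1M => //; [exact: L|exact: L'].
- by apply: L1D; apply: L1M => //; [exact: L|exact: L'].
Qed.

Lemma solution_continuous al be f u z : L1 f -> solution al be f u z ->
  continuous u /\ continuous z.
Proof.
move=> fL [mu_ mz uE zE]; split.
  rewrite (funext uE).
  move=> x; apply: cvgD; first exact: cvg_cst.
  by apply: prim_continuous; apply: L1D; exact: L1M.
rewrite (funext zE).
move=> x; apply: cvgD; first exact: cvg_cst.
by apply: prim_continuous; apply: L1B => //; apply: L1D; exact: L1M.
Qed.

Variables (c d : R).
Hypotheses (cd : c < d) (k1S : supported c d k1) (k2S : supported c d k2)
  (k3S : supported c d k3).
Hypothesis k1_neq0 : {ae mu, forall x, `]c, d[%classic x -> k1 x != 0}.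
Hypotheses (k1M : (\int[mu]_t `|k1 t|)%R <= 4^-1)
  (k2M : (\int[mu]_t `|k2 t|)%R <= 4^-1) (k3M : (\int[mu]_t `|k3 t|)%R <= 4^-1).

Lemma solution_ex (al be : R) f : L1 f -> exists u z, solution al be f u z.
Proof.
move=> fL.
have mG : mbounded (fun x => be + prim f x).
  by apply: mboundedD; [exact: mbounded_cst|exact: mbounded_prim].
have [u [z [mu_ mz uE zE]]] :=
  volterra k1L k2L k3L k1M k2M k3M (mbounded_cst al) mG.
exists u, z; split=> // x; rewrite zE primB ?addrA//.
by apply: L1D; exact: L1M.
Qed.

Lemma solution_left al be f u z x : supported c d f ->
  solution al be f u z -> x <= c -> u x = al /\ z x = be.
Proof.
move=> fS [_ _ uE zE] xc; rewrite uE zE !(@prim_supported_le c d)//.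
- by rewrite !addr0.
- by move=> t tcd; rewrite fS// k3S// k2S// !mul0r addr0 subr0.
- by move=> t tcd; rewrite k1S// k2S// !mul0r addr0.
Qed.

Lemma solution_right al be f u z x : L1 f -> supported c d f ->
  solution al be f u z -> d <= x -> u x = u d /\ z x = z d.
Proof.
move=> fL fS [mu_ mz uE zE] dx; rewrite uE zE (uE d) (zE d).
by split; congr (_ + _); apply: (@prim_supported_ge c d) => //;
  [apply: L1D; exact: L1M|move=> t tcd; rewrite k1S// k2S// !mul0r addr0
  |apply: L1B => //; apply: L1D; exact: L1M
  |move=> t tcd; rewrite fS// k3S// k2S// !mul0r addr0 subr0].
Qed.

Lemma L1_0 : L1 (fun=> 0 : R).
Proof. exact: integrable0. Qed.

(* Only the trivial homogeneous solution vanishes on [`]c, d[]: there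
   [0 = u' = k1 z], hence [z] vanishes as well. *)
Lemma homogeneous_eq0 (al be : R) u z : solution al be (fun=> 0) u z ->
  {ae mu, forall x, `]c, d[%classic x -> u x = 0} -> al = 0 /\ be = 0.
Proof.
move=> S u0; have [mu_ mz uE zE] := S.
have [cu cz] := solution_continuous L1_0 S.
have {}u0 x : x \in `]c, d[ -> u x = 0.
  by apply: ae_eq_continuous => // y _; exact: cu.
have gL : L1 (fun t => k2 t * u t + k1 t * z t) by apply: L1D; exact: L1M.
have [|x /=] := @ae_itv_ex _ c d (fun x => z x = 0) cd.
  have dp := prim_derive gL; have F := ae_filter_ringOfSetsType mu.
  apply: filterS2 k1_neq0 dp => /= x k1x [_ gx] xcd.
  (* By contraposition: [u] is constant near [x], so its derivative [k2 u + k1 z] vanishes at [x],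
     and [z x != 0] would force [k1 x = 0]. *)
  apply/eqP; move: (k1x xcd); apply: contraNT => zx; apply/eqP.
  have : k2 x * u x + k1 x * z x = 0.
    rewrite -gx.
    have -> : prim (fun t => k2 t * u t + k1 t * z t) = fun x => u x - al.
      by apply/funext => y; rewrite uE addrC addKr.
    rewrite -(derive1_cst (- al) x); apply: near_eq_derive1; near=> y.
    by rewrite u0 ?sub0r//; near: y; exact: near_in_itvoo.
  by rewrite u0// mulr0 add0r => /eqP; rewrite mulf_eq0 (negbTE zx) orbF => /eqP.
rewrite in_itv/= => xcd zx; have ux : u x = 0 by apply: u0; rewrite in_itv.
(* At this point [u] and [z] both vanish, so Lagrange's identity against the solutions starting at
   (1, 0) and (0, 1) gives [be = 0] and [al = 0]. *)
have [v1 [w1 S1]] := solution_ex 1 0 L1_0.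
have [v2 [w2 S2]] := solution_ex 0 1 L1_0.
have := lagrange x L1_0 L1_0 S S1; have := lagrange x L1_0 L1_0 S S2.
rewrite ux zx !mul0r subrr.
under [X in prim X x]eq_fun do rewrite !mulr0 subrr.
under [X in _ -> _ = _ + prim X x -> _]eq_fun do rewrite !mulr0 subrr.
by rewrite prim0; lra.
Unshelve. all: by end_near. Qed.

(* By [lagrange], reaching [(ga, de)] amounts to prescribing the integrals of
   [f v1] and [f v2], where [v1] and [v2] are the fundamental homogeneous
   solutions; a combination of [v1] and [v2] does it because their Gram matrix
   on [`]c, d[] is invertible, by [homogeneous_eq0]. *)
Lemma control_ex (al be ga de : R) : exists f u z,
  [/\ mbounded f, supported c d f, solution al be f u z,
    forall x, x <= c -> u x = al /\ z x = be &
    forall x, d <= x -> u x = ga /\ z x = de].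
Proof.
have [v1 [w1 S1]] := solution_ex 1 0 L1_0.
have [v2 [w2 S2]] := solution_ex 0 1 L1_0.
have [mv1 _ _ _] := S1; have [mv2 _ _ _] := S2.
have m1 : mbounded (\1_`]c, d[%classic : R -> R).
  split; first exact: measurable_indic.
  by exists 1 => x; rewrite indicE; case: (_ \in _); rewrite ?normr1 ?normr0.
pose q (v v' : R -> R) t := \1_`]c, d[%classic t * (v t * v' t) : R.
have qL v v' : mbounded v -> mbounded v' -> L1 (q v v').
  move=> mv mv'; apply: L1M; last exact: mboundedM.
  exact: integrable_indic_itv.
have qS v v' : supported c d (q v v').
  move=> x xcd; rewrite /q indicE memNset ?mul0r//= => xcd'.
  by rewrite xcd' in xcd.
(* The inner product of L_2 on []c, d[]; its Gram matrix on [v1], [v2] has to be inverted. *)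
pose G v v' := prim (q v v') d.
pose comb (s t : R) x := s * v1 x + t * v2 x.
have mcomb s t : mbounded (comb s t).
  by apply: mboundedD; apply: mboundedM => //; exact: mbounded_cst.
have Gcomb s t v : mbounded v -> G (comb s t) v = s * G v1 v + t * G v2 v.
  move=> mv; rewrite /G -!primZ -?primD; [|exact/L1Z/qL|exact/L1Z/qL|exact: qL..].
  by apply: eq_prim => x _; rewrite /q /comb; ring.
have GC v v' : G v v' = G v' v.
  by apply: eq_prim => x _; rewrite /q (mulrC (v x)).
(* Definiteness: an integral of a square that is zero makes the combination vanish almost everywhere
   on []c, d[], and it is itself a homogeneous solution with initial values [s] and [t]. *)
have Gdef s t : G (comb s t) (comb s t) = 0 -> s = 0 /\ t = 0.
  move=> G0.
  have St : solution s t (fun=> 0) (comb s t) (fun x => s * w1 x + t * w2 x).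
    have := solution_lin s t L1_0 L1_0 S1 S2.
    rewrite !mulr1 !mulr0 addr0 add0r; congr solution.
    by apply/funext => x; rewrite addr0.
  apply: (homogeneous_eq0 St).
  have q0 x : 0 <= q (comb s t) (comb s t) x.
    by rewrite mulr_ge0// -expr2 sqr_ge0.
  have : (\int[mu]_(x in `]-oo, d]) `|(q (comb s t) (comb s t) x)%:E| = 0)%E.
    under eq_integral do rewrite gee0_abs ?lee_fin//.
    transitivity (G (comb s t) (comb s t))%:E; last by rewrite G0.
    by apply: L1_Rintegral => //; exact: qL.
  move/ae_eq_integral_abs => [||A [mA A0 qA]] //.
    exact: measurable_int (L1S _ (qL _ _ _ _)).
  exists A; split=> // x /= /not_implyP [xcd cx]; apply: qA => /= qx.
  apply: cx; move: xcd; rewrite in_itv/= => /andP[cx xd].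
  have := qx _; rewrite in_itv/= (ltW xd) => /(_ isT) [].
  rewrite /q indicE mem_set/= ?in_itv/= ?cx// mul1r => /eqP.
  by rewrite mulf_eq0 orbb => /eqP.
have det0 : G v1 v1 * G v2 v2 - G v1 v2 ^+ 2 != 0.
  apply/eqP => det0.
  (* A singular Gram matrix has this vector in its kernel, so [G v2 v2 = 0]; then [v2] itself
     contradicts definiteness. *)
  have [] := Gdef (G v2 v2) (- G v1 v2).
    rewrite Gcomb// GC Gcomb// [G v2 (comb _ _)]GC Gcomb// (GC v2 v1).
    by rewrite -[RHS](mulr0 (G v2 v2)) -det0; ring.
  move=> G22 _; have [] := Gdef 0 1.
    by rewrite Gcomb// GC Gcomb// [G v2 (comb _ _)]GC Gcomb// G22; ring.
  by move=> _ /eqP; rewrite oner_eq0.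
set D := G v1 v1 * G v2 v2 - G v1 v2 ^+ 2 in det0.
(* [r1] and [r2] are the integrals of [f v1] and [f v2] that Lagrange's identity at [d] demands when
   (u, z)(d) = (ga, de); [s] and [t] come from Cramer's rule. *)
pose r1 := - be - ga * w1 d + de * v1 d.
pose r2 := al - ga * w2 d + de * v2 d.
pose s := (r1 * G v2 v2 - r2 * G v1 v2) / D.
pose t := (r2 * G v1 v1 - r1 * G v1 v2) / D.
have E1 : G (comb s t) v1 = r1.
  by rewrite Gcomb// (GC v2) /s /t; move: det0; rewrite /D => ?; field.
have E2 : G (comb s t) v2 = r2.
  by rewrite Gcomb// /s /t; move: det0; rewrite /D => ?; field.
pose f x := q (comb s t) (cst 1) x.
have fL : L1 f by apply: qL => //; exact: mbounded_cst.
have mf : mbounded f.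
  by apply: mboundedM => //; apply: mboundedM => //; exact: mbounded_cst.
have fS : supported c d f by exact: qS.
have [u [z S]] := solution_ex al be fL.
exists f, u, z; split=> // x; first exact: solution_left S.
move=> dx; have [-> ->] := solution_right fL fS S dx.
have e1 := lagrange d fL L1_0 S S1; have e2 := lagrange d fL L1_0 S S2.
have e3 := lagrange d L1_0 L1_0 S1 S2.
have F v : mbounded v -> prim (fun t => u t * 0 - v t * f t) d = - G (comb s t) v.
  move=> mv.
  rewrite -mulN1r -primZ; last exact: qL.
  apply: eq_prim => y _; rewrite /f /q /=; ring.
have F0 v v' : prim (fun t => v t * 0 - v' t * 0 : R) d = 0.
  rewrite -[RHS](prim0 d); apply: eq_prim => y _; ring.
rewrite F// E1 /r1 in e1; rewrite F// E2 /r2 in e2; rewrite F0 in e3.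
(* The errors [u d - ga] and [z d - de] solve a homogeneous linear system whose determinant is, up
   to sign, this Wronskian, so both are zero. *)
have W : v1 d * w2 d - w1 d * v2 d = 1 by lra.
have a1 : (u d - ga) * w1 d = (z d - de) * v1 d by lra.
have a2 : (u d - ga) * w2 d = (z d - de) * v2 d by lra.
split; apply/eqP; rewrite -subr_eq0; apply/eqP.
- transitivity (v1 d * ((u d - ga) * w2 d) - v2 d * ((u d - ga) * w1 d)).
    by rewrite -[LHS]mulr1 -W; ring.
  by rewrite a1 a2; ring.
- transitivity (w2 d * ((z d - de) * v1 d) - w1 d * ((z d - de) * v2 d)).
    by rewrite -[LHS]mulr1 -W; ring.
  by rewrite -a1 -a2; ring.
Qed.

End kernels.
End control.

(** * Absolutely continuous complex-valued functions *)

Section absolute_continuity.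
Context {R : realType}.
Local Notation mu := (@lebesgue_measure R).
Local Notation normc := (@Normc.normc R).
Variables (a b : R).
Hypothesis ab : a < b.
Local Notation J := (`]a, b[%classic : set R).
Implicit Types (y g h u v : R -> R[i]) (x : R).

Lemma normc_le (r s : R) : normc (r +i* s)%C <= `|r| + `|s|.
Proof.
rewrite /= -(ler_pXn2r (n := 2))// ?nnegrE ?sqrtr_ge0 ?addr_ge0//.
rewrite sqr_sqrtr ?addr_ge0 ?sqr_ge0// sqrrD -(real_normK (num_real r)).
by rewrite -(real_normK (num_real s)) -addrA [X in _ <= _ + X]addrC lerD2l lerDl mulrn_wge0// mulr_ge0.
Qed.

Lemma normc_ge0 (z : R[i]) : 0 <= normc z.
Proof. by case: z => r s; exact: sqrtr_ge0. Qed.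

Lemma normcB (z w : R[i]) : normc (z - w) = normc (w - z).
Proof. by rewrite -opprB; exact: (@normcN R). Qed.

Lemma normc_triangle (z w t : R[i]) : normc (z - w) <= normc (z - t) + normc (t - w).
Proof. by rewrite -(subrKA t); exact: (@le_normcD R). Qed.

Lemma in_ACS (a' b' : R) y : a <= a' -> b' <= b -> in_AC a b y -> in_AC a' b' y.
Proof.
move=> aa' bb' yAC e e0; have [d d0 Hd] := yAC e e0.
exists d => // n s t st; apply: Hd => i; have [h1 h2 h3] := st i.
by split=> //; [exact: le_trans h1|exact: le_trans bb'].
Qed.

Lemma in_AC_dist y (e : R) : in_AC a b y -> 0 < e -> exists2 d : R, 0 < d &
  forall s t, s \in `[a, b] -> t \in `[a, b] -> `|t - s| < d ->
    normc (y t - y s) < e.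
Proof.
move=> yAC e0; have [d d0 Hd] := yAC e e0; exists d => // s t.
wlog st : s t / s <= t.
  move=> H sab tab std; have [st|/ltW ts] := leP s t; first exact: H.
  by rewrite normcB H// distrC.
rewrite !in_itv/= => /andP[as_ _] /andP[_ tb]; rewrite ger0_norm ?subr_ge0// => std.
have := Hd 1%N (fun=> s) (fun=> t); rewrite !big_ord1; apply => //.
by move=> i j _ _ _; rewrite (ord1 i) (ord1 j).
Qed.

(** Arbitrarily close to any point of [[a, b]], end points included, there is an interior point
    where both functions agree, and both are continuous. This is what makes the values of [D1] at
    [a] and [b] well determined. *)
Lemma in_AC_eq y g : in_AC a b y -> in_AC a b g -> ae_eq mu J y g ->
  forall x, x \in `[a, b] -> y x = g x.
Proof.
move=> yAC gAC yg x xab; have xab' := xab; rewrite in_itv/= in xab'.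
case/andP: xab' => ax xb.
apply/eqP; rewrite -subr_eq0; apply/eqP/Normc.eq0_normc/le_anti.
rewrite normc_ge0 andbT; apply/ler_addgt0Pr => e e0; rewrite add0r.
have e20 : 0 < e / 2 by rewrite divr_gt0.
have [d1 d10 H1] := in_AC_dist yAC e20; have [d2 d20 H2] := in_AC_dist gAC e20.
pose d := Num.min d1 d2; have d0 : 0 < d by rewrite lt_min d10 d20.
have [||t] := @ae_itv_ex _ (Num.max a (x - d)) (Num.min b (x + d))
    (fun t => J t -> y t = g t).
- rewrite gt_max !lt_min ab /=.
  by apply/and3P; split; lra.
- have F := ae_filter_ringOfSetsType mu.
  by apply: filterS yg => t /= yt _.
rewrite /= in_itv/= gt_max !lt_min => /andP[/andP[at_ xdt] /andP[tb txd]].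
rewrite in_itv/= at_ tb => /(_ isT) ytg.
have tab : t \in `[a, b] by rewrite in_itv/= !ltW.
have td : `|x - t| < d by rewrite ltr_norml; apply/andP; split; lra.
have := td; rewrite lt_min => /andP[td1 td2].
rewrite (le_trans (normc_triangle _ _ (y t)))// [X in _ + X]normcB ytg normcB [e]splitr.
by apply: lerD; apply: ltW; [rewrite normcB -ytg; exact: H1|exact: H2].
Qed.

Lemma in_AC_prim (al be : R) (f g : R -> R) : L1 f -> L1 g ->
  in_AC a b (fun x => (al + prim f x) +i* (be + prim g x))%C.
Proof.
move=> fL gL e e0; have e20 : 0 < e / 2 by rewrite divr_gt0.
have [d1 d10 H1] := prim_AC fL e20; have [d2 d20 H2] := prim_AC gL e20.
exists (Num.min d1 d2) => [|n s t st tI]; first by rewrite lt_min d10.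
rewrite lt_min => /andP[std1 std2].
have le_st i : s i <= t i by have [] := st i.
rewrite [e]splitr (le_lt_trans _ (ltrD (H1 _ _ _ le_st tI std1) (H2 _ _ _ le_st tI std2)))//.
rewrite -big_split/=; apply: ler_sum => i _.
have E c k : prim k (t i) - prim k (s i) = c + prim k (t i) - (c + prim k (s i)).
  by ring.
by rewrite (E al f) (E be g); exact: normc_le.
Qed.

End absolute_continuity.

(** * Quasi-derivatives and membership in the maximal domain *)

Section quasi_derivatives.
Context {R : realType}.
Local Notation mu := (@lebesgue_measure R).
Variables (a b : R) (p Q : R -> R).
Hypothesis ab : a < b.
Local Notation J := (`]a, b[%classic : set R).
Local Notation D1 := (D1 a b p Q).
Local Notation D1_formula := (D1_formula p Q).
Local Notation Dom_Lmax := (Dom_Lmax a b p Q).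
Implicit Types (y : R -> R[i]) (f g h u z : R -> R) (x : R).

Lemma ae_eq_D1 y : ae_eq mu J (D1 y) (D1_formula y).
Proof. by rewrite /D1; case: xgetP => [u _ []//|_]; exact: ae_eq_refl. Qed.

Lemma eq_cderive y y' x : (\forall t \near x, y t = y' t) ->
  cderive y x = cderive y' x.
Proof.
by move=> yg; rewrite /cderive; congr (_ +i* _)%C; apply: near_eq_derive1;
  apply: filterS yg => t ->.
Qed.

(** The formula for the quasi-derivative is local, so the two versions agree almost everywhere on
    []c, d[]; uniqueness of the absolutely continuous version extends this to [c] and [d]. With
    [c = a] or [d = b] the boundary values are seen to depend on the germ only. *)
Lemma D1_local y y' (c d : R) : a <= c -> c < d -> d <= b ->
  Dom_Lmax y -> Dom_Lmax y' -> (forall x, x \in `]c, d[ -> y x = y' x) ->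
  forall x, x \in `[c, d] -> y x = y' x /\ D1 y x = D1 y' x.
Proof.
move=> ac cd db [_ yAC DyAC _] [_ yAC' DyAC' _] yy x xcd.
have F := ae_filter_ringOfSetsType mu.
split; apply: (in_AC_eq cd) xcd; try exact: (in_ACS ac db).
  by apply: aeW => t /= tcd; exact: yy.
apply: filterS2 (ae_eq_D1 y) (ae_eq_D1 y') => t /= yt yt' tcd.
have tJ : t \in `]a, b[ by move: tcd; rewrite !in_itv/=; lra.
rewrite yt// yt'// /Defs.D1_formula yy// (@eq_cderive y y')//.
by near=> s; apply: yy; near: s; exact: near_in_itvoo.
Unshelve. all: by end_near. Qed.

(* [z] and [f] are the quasi-derivatives of orders 1 and 2 of [u], given through
   primitives so that no absolutely continuous version has to be chosen. *)
Definition cert f u z := exists (al be : R) g h,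
  [/\ L1 g, L1 h, forall x, u x = al + prim g x & forall x, z x = be + prim h x] /\
  mbounded f /\
  {ae mu, forall x, J x -> p x * g x - Q x * u x = z x /\
    h x + Q x / p x * z x + Q x ^+ 2 / p x * u x = f x}.

Lemma certD f u z f' u' z' : cert f u z -> cert f' u' z' ->
  cert (fun x => f x + f' x) (fun x => u x + u' x) (fun x => z x + z' x).
Proof.
move=> [al [be [g [h [[gL hL uE zE] [mf E]]]]]].
move=> [al' [be' [g' [h' [[gL' hL' uE' zE'] [mf' E']]]]]].
exists (al + al'), (be + be'), (fun x => g x + g' x), (fun x => h x + h' x).
split; first split.
- exact: L1D.
- exact: L1D.
- by move=> x; rewrite primD// uE uE'; ring.
- by move=> x; rewrite primD// zE zE'; ring.
split; first exact: mboundedD.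
have F := ae_filter_ringOfSetsType mu.
by apply: filterS2 E E' => x Ex Ex' xJ; have [<- <-] := Ex xJ;
  have [<- <-] := Ex' xJ; split; ring.
Qed.

Lemma in_L2_mbounded (f g : R -> R) y : mbounded f -> mbounded g ->
  ae_eq mu J y (fun x => f x +i* g x)%C -> in_L2 J y.
Proof.
move=> mf mg yE; exists (fun x => f x +i* g x)%C; split=> //=.
- by apply: measurable_funTS; exact: mf.1.
- by apply: measurable_funTS; exact: mg.1.
have [mk [C kC]] := mboundedD (mboundedM mf mf) (mboundedM mg mg).
apply: (@le_lt_trans _ _ (\int[mu]_(x in J) (f x * f x + g x * g x)%:E)%E).
  rewrite le_eqVlt; apply/orP; left; apply/eqP; apply: eq_integral => x _.
  by rewrite sqr_sqrtr ?addr_ge0 ?sqr_ge0// !expr2.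
apply: integrable_lty => //; apply: measurable_bounded_integrable => //.
- by rewrite /= lebesgue_measure_itv/= lte_fin ab -EFinD ltry.
- exact: measurable_funTS.
- by exists C; split=> [|M CM x _]; [exact: num_real|exact: le_trans (kC x) (ltW CM)].
Qed.

(** Since [p] and [Q] are real, the real and imaginary parts can be certified separately. Membership
    in L_2 is clear because everything is bounded on a finite interval. *)
Lemma cert_Dom f u z f' u' z' : cert f u z -> cert f' u' z' ->
  Dom_Lmax (fun x => u x +i* u' x)%C /\
  forall x, x \in `[a, b] -> D1 (fun x => u x +i* u' x)%C x = (z x +i* z' x)%C.
Proof.
move=> [al [be [g [h [[gL hL uE zE] [mf E]]]]]].
move=> [al' [be' [g' [h' [[gL' hL' uE' zE'] [mf' E']]]]]].
set y := fun x => (u x +i* u' x)%C; pose Z x := (z x +i* z' x)%C.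
have uP := funext uE; have uP' := funext uE'.
have zP := funext zE; have zP' := funext zE'.
have F := ae_filter_ringOfSetsType mu.
have yAC : in_AC a b y by rewrite /y uP uP'; exact: in_AC_prim.
have ZAC : in_AC a b Z by rewrite /Z zP zP'; exact: in_AC_prim.
have prim_cst_derive (c : R) (k : R -> R) : L1 k ->
    {ae mu, forall x, derive1 (fun t => c + prim k t) x = k x}.
  move=> kL; apply: filterS (prim_derive kL) => x [dk dkx].
  by rewrite derive1E deriveD// derive_cst add0r -derive1E.
have dy : ae_eq mu J (D1_formula y) Z.
  have := prim_cst_derive al' _ gL'; have := prim_cst_derive al _ gL.
  rewrite -uP -uP' => ud ud'.
  apply: filterS2 (filterI ud ud') (filterI E E') => x [ux ux'] [Ex Ex'] xJ.
  have [zx _] := Ex xJ; have [zx' _] := Ex' xJ.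
  rewrite /Defs.D1_formula /cderive /= ux ux' /Z -zx -zx'.
  by apply/eqP; rewrite eq_complex /=; apply/andP; split; apply/eqP; ring.
(* [Z] is an absolutely continuous version of the formula, so the choice made in [D1] does not fall
   back on its default. *)
have D1AC : in_AC a b (D1 y) /\ ae_eq mu J (D1 y) Z.
  have [AC1 E1] : in_AC a b (D1 y) /\ ae_eq mu J (D1 y) (D1_formula y).
    by apply: (@xgetI _ (D1_formula y) [set v | in_AC a b v /\
      ae_eq mu J v (D1_formula y)] Z); split=> //; exact: ae_eq_sym.
  by split=> //; exact: ae_eq_trans dy.
have D1E x : x \in `[a, b] -> D1 y x = Z x.
  by apply: in_AC_eq => //; [exact: D1AC.1|exact: D1AC.2].
split=> //; split=> //.
- apply: (@in_L2_mbounded u u'); last exact: ae_eq_refl.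
    rewrite uP; apply: mboundedD; [exact: mbounded_cst|exact: mbounded_prim].
  rewrite uP'; apply: mboundedD; [exact: mbounded_cst|exact: mbounded_prim].
- exact: D1AC.1.
apply: (in_L2_mbounded mf mf').
have := prim_cst_derive be' _ hL'; have := prim_cst_derive be _ hL.
rewrite -zP -zP' => zd zd'.
apply: filterS2 (filterI zd zd') (filterI E E') => x [zx zx'] [Ex Ex'] xJ.
have [_ fx] := Ex xJ; have [_ fx'] := Ex' xJ.
rewrite /D2 D1E; last by move: xJ; rewrite /= !in_itv/=; lra.
rewrite (@eq_cderive _ Z); last first.
  near=> t; apply: D1E; apply: subset_itv_oo_cc.
  by near: t; exact: near_in_itvoo.
rewrite /cderive /= zx zx' -fx -fx'.
by apply/eqP; rewrite eq_complex /=; apply/andP; split; apply/eqP; ring.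
Unshelve. all: by end_near. Qed.

End quasi_derivatives.

(** * Germs at the two end points *)

Section germs.
Context {R : realType}.
Variables (a b : R).
Implicit Types y g : R -> R[i].

Lemma near_same_germ (c : R) y g : (\forall x \near c, y x = g x) ->
  same_germ a b c y g.
Proof. by move=> yg; exact: (@filterS _ (nbhs c) _ _ _ (fun x yx _ => yx) yg). Qed.

Lemma same_germ_left y g : a < b -> same_germ a b a y g ->
  exists2 c, a < c <= b & forall x, x \in `]a, c[ -> y x = g x.
Proof.
move=> ab [e /= e0 He]; exists (Num.min b (a + e)).
  by rewrite lt_min ab ltrDl e0 ge_min lexx.
move=> x; rewrite in_itv/= lt_min => /and3P[ax xb xe]; apply: He.
  by rewrite /ball/= ltr0_norm ?subr_lt0// opprB ltrBlDl.
by rewrite /= in_itv/= !ltW.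
Qed.

Lemma same_germ_right y g : a < b -> same_germ a b b y g ->
  exists2 c, a <= c < b & forall x, x \in `]c, b[ -> y x = g x.
Proof.
move=> ab [e /= e0 He]; exists (Num.max a (b - e)).
  by rewrite gt_max ab ltrBlDr ltrDl e0 le_max lexx.
move=> x; rewrite in_itv/= gt_max => /andP[/andP[ax xe] xb]; apply: He.
  by rewrite /ball/= gtr0_norm ?subr_gt0// ltrBlDl -ltrBlDr.
by rewrite /= in_itv/= !ltW.
Qed.

End germs.

(** * Elements of the maximal domain with prescribed boundary values *)

Section interpolation.
Context {R : realType}.
Local Notation mu := (@lebesgue_measure R).
Variables (a b : R) (p Q : R -> R).
Hypothesis ab : a < b.
Local Notation J := (`]a, b[%classic : set R).
Local Notation D1 := (D1 a b p Q).
Local Notation Dom_Lmax := (Dom_Lmax a b p Q).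
Local Notation cert := (cert a b p Q).
Hypothesis p_neq0 : {ae mu, forall x, J x -> p x != 0}.
Hypotheses (p1 : in_L1 J (fun x => 1 / p x)) (p2 : in_L1 J (fun x => Q x / p x))
  (p3 : in_L1 J (fun x => Q x ^+ 2 / p x)).

Lemma in_L1_ext f : in_L1 J f -> exists2 k, L1 k & ae_eq mu J f k.
Proof.
move=> [g gJ fg]; exists (g \_ J).
  by move: gJ; rewrite integrable_mkcond//= restrict_EFin.
have F := ae_filter_ringOfSetsType mu.
by apply: filterS fg => x /= fgx xJ; rewrite fgx// patchE mem_set.
Qed.

Lemma L1_small_itv (k : R -> R) (e : R) : L1 k -> 0 < e -> exists2 r : R, 0 < r &
  forall c d, c < d -> d - c < r -> (\int[mu]_(x in `]c, d[) `|k x|)%R <= e.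
Proof.
move=> kL e0; have [r [r0 Hr]] := integral_normr_continuous kL e0.
exists r => // c d cd dcr; apply: ltW; apply: Hr => //=.
by rewrite lebesgue_measure_itv/= lte_fin cd -EFinD lte_fin.
Qed.

(** The number [r] makes the three kernels have integral at most 1/4 on every interval shorter than
    [r]. Outside []c, d[] the pair (u, z) is constant, which is compatible with the equation on []a,
    b[] because the constants are required to be 0 on each side that meets []a, b[]. *)
Lemma cert_ex : exists2 r : R, 0 < r & forall c d, a <= c -> c < d -> d <= b ->
  d - c < r -> forall al be ga de : R,
  (a < c -> al = 0 /\ be = 0) -> (d < b -> ga = 0 /\ de = 0) ->
  exists f u z, [/\ cert f u z, forall x, x <= c -> u x = al /\ z x = be &
    forall x, d <= x -> u x = ga /\ z x = de].
Proof.
have [k1 k1L k1E] := in_L1_ext p1.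
have [k2 k2L k2E] := in_L1_ext p2.
have [k3 k3L k3E] := in_L1_ext p3.
have F := ae_filter_ringOfSetsType mu.
have q0 : 0 < 4^-1 :> R by rewrite invr_gt0.
have [r1 r10 H1] := L1_small_itv k1L q0.
have [r2 r20 H2] := L1_small_itv k2L q0.
have [r3 r30 H3] := L1_small_itv k3L q0.
exists (Num.min r1 (Num.min r2 r3)) => [|c d ac cd db]; first by rewrite !lt_min r10 r20.
rewrite !lt_min => /and3P[dc1 dc2 dc3] al be ga de al0 ga0.
have cdJ x : x \in `]c, d[ -> J x by rewrite /= !in_itv/=; lra.
(* Cutting the kernels off outside []c, d[] provides the supports and the smallness that
   [control_ex] asks for. *)
pose ind (k : R -> R) x : R := k x * \1_`]c, d[%classic x.
have indL k : L1 k -> L1 (ind k) by exact: L1_indic.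
have indE k x : x \in `]c, d[ -> ind k x = k x.
  by move=> xcd; rewrite /ind indicE mem_set// mulr1.
have indS k : supported c d (ind k).
  by move=> x xcd; rewrite /ind indicE memNset ?mulr0//= => h; rewrite h in xcd.
have indI k : (\int[mu]_x `|ind k x|)%R = (\int[mu]_(x in `]c, d[) `|k x|)%R.
  rewrite -(Rintegral_indic _ (fun x => `|k x|)); apply: eq_Rintegral => x _.
  by rewrite normrM [X in _ * X]ger0_norm.
have k1_neq0 : {ae mu, forall x, `]c, d[%classic x -> ind k1 x != 0}.
  apply: filterS2 p_neq0 k1E => x px kx xcd; have xJ := cdJ x xcd.
  by rewrite indE// -kx// div1r invr_neq0// px.
have [|||f [u [z [mf fS S ul ur]]]] := control_ex (indL _ k1L) (indL _ k2L) (indL _ k3L)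
    cd (indS k1) (indS k2) (indS k3) k1_neq0 _ _ _ al be ga de.
- by rewrite indI H1.
- by rewrite indI H2.
- by rewrite indI H3.
exists f, u, z; split=> //.
have [mu_ mz uE zE] := S.
exists al, be, (fun t => ind k2 t * u t + ind k1 t * z t).
exists (fun t => f t - (ind k3 t * u t + ind k2 t * z t)); split; first split=> //.
- by apply: L1D; apply: L1M => //; exact: indL.
- apply: L1B; last by apply: L1D; apply: L1M => //; exact: indL.
  exact: L1_supported mf fS.
split=> //.
apply: filterS2 (filterI p_neq0 k1E) (filterI k2E k3E) => x [px e1] [e2 e3] xJ.
have [xcd|xcd] := boolP (x \in `]c, d[).
  rewrite !indE// -e1// -e2// -e3//; have {}px := px xJ.
  by split; field.
rewrite !indS// fS//.
have [-> ->] : u x = 0 /\ z x = 0.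
  move: xJ xcd; rewrite /= !in_itv/= => /andP[ax xb].
  rewrite negb_and -!leNgt => /orP[xc|dx].
    have [-> ->] := ul x xc; apply: al0; exact: lt_le_trans xc.
  have [-> ->] := ur x dx; apply: ga0; exact: le_lt_trans xb.
by split; ring.
Qed.

Lemma cert0 : cert (fun=> 0) (fun=> 0) (fun=> 0).
Proof.
exists 0, 0, (fun=> 0), (fun=> 0); split; first split.
- exact: L1_0.
- exact: L1_0.
- by move=> x; rewrite prim0 addr0.
- by move=> x; rewrite prim0 addr0.
split; first exact: mbounded_cst.
by apply: aeW => x _; split; ring.
Qed.

(** [g] steers the data at [a] to zero on a short interval at [a], [h] steers zero to the data at
    [b] on a short interval at [b], and [y = g + h]. *)
Lemma interpolation (A B C D : R[i]) : exists y g h,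
  [/\ Dom_Lmax y, Dom_Lmax g & Dom_Lmax h] /\
  [/\ same_germ a b a g y, same_germ a b b g (cst 0),
      same_germ a b a h (cst 0) & same_germ a b b h y] /\
  [/\ y a = A, D1 y a = B, y b = C & D1 y b = D] /\
  [/\ g a = A, D1 g a = B, g b = 0 & D1 g b = 0] /\
  [/\ h a = 0, D1 h a = 0, h b = C & D1 h b = D].
Proof.
have [r r0 Hr] := cert_ex.
(* Less than [r] for solvability, and at most a third of the length so that the two end intervals
   are disjoint. *)
pose e := Num.min (r / 2) ((b - a) / 3).
have er : e < r by rewrite gt_min; apply/orP; left; lra.
have eab : e <= (b - a) / 3 by rewrite ge_min lexx orbT.
have e0 : 0 < e by rewrite lt_min !divr_gt0 ?subr_gt0.
have L (al be : R) : exists f u z, [/\ cert f u z,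
    forall x, x <= a -> u x = al /\ z x = be &
    forall x, a + e <= x -> u x = 0 /\ z x = 0].
  by apply: Hr => //; lra.
have L' (ga de : R) : exists f u z, [/\ cert f u z,
    forall x, x <= b - e -> u x = 0 /\ z x = 0 &
    forall x, b <= x -> u x = ga /\ z x = de].
  by apply: Hr => //; lra.
have [f1 [u1 [z1 [c1 l1 r1]]]] := L (complex.Re A) (complex.Re B).
have [f2 [u2 [z2 [c2 l2 r2]]]] := L (complex.Im A) (complex.Im B).
have [f3 [u3 [z3 [c3 l3 r3]]]] := L' (complex.Re C) (complex.Re D).
have [f4 [u4 [z4 [c4 l4 r4]]]] := L' (complex.Im C) (complex.Im D).
have [Dg D1g] := cert_Dom ab c1 c2.
have [Dh D1h] := cert_Dom ab c3 c4.
have [Dy D1y] := cert_Dom ab (certD c1 c3) (certD c2 c4).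
have aI : a \in `[a, b] by rewrite in_itv/= lexx ltW.
have bI : b \in `[a, b] by rewrite in_itv/= lexx ltW.
have abe : a < b - e by lra.
have aeb : a + e < b by lra.
have [[u1a z1a] [u2a z2a]] := (l1 a (lexx a), l2 a (lexx a)).
have [[u3a z3a] [u4a z4a]] := (l3 a (ltW abe), l4 a (ltW abe)).
have [[u1b z1b] [u2b z2b]] := (r1 b (ltW aeb), r2 b (ltW aeb)).
have [[u3b z3b] [u4b z4b]] := (r3 b (lexx b), r4 b (lexx b)).
have eta (Z : R[i]) : (complex.Re Z +i* complex.Im Z)%C = Z by case: Z.
have near_a : \forall x \near a, x < b - e.
  have := @near_in_itvNyo R (b - e) a; rewrite in_itv => /(_ abe).
  by apply: filterS => x; rewrite in_itv.
have near_b : \forall x \near b, a + e < x.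
  have := @near_in_itvoy R (a + e) b; rewrite in_itv/= andbT => /(_ aeb).
  by apply: filterS => x; rewrite in_itv/= andbT.
do 3 eexists; split; first by split; [exact: Dy|exact: Dg|exact: Dh].
split; last split; last split.
- split; apply: near_same_germ.
  + apply: filterS near_a => x /ltW xb.
    by have [-> _] := l3 x xb; have [-> _] := l4 x xb; rewrite !addr0.
  + by apply: filterS near_b => x /ltW ax; have [-> _] := r1 x ax; have [-> _] := r2 x ax.
  + by apply: filterS near_a => x /ltW xb; have [-> _] := l3 x xb; have [-> _] := l4 x xb.
  + apply: filterS near_b => x /ltW ax.
    by have [-> _] := r1 x ax; have [-> _] := r2 x ax; rewrite !add0r.
- rewrite (D1y a aI) (D1y b bI) u1a u2a u3a u4a u1b u2b u3b u4b.
  by rewrite z1a z2a z3a z4a z1b z2b z3b z4b !addr0 !add0r !eta.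
- by rewrite (D1g a aI) (D1g b bI) u1a u2a u1b u2b z1a z2a z1b z2b !eta.
- by rewrite (D1h a aI) (D1h b bI) u3a u4a u3b u4b z3a z4a z3b z4b !eta.
Qed.

End interpolation.

(** * Matrix entries and the operator norm *)

Section hermitian.
Context {R : realType}.
Local Notation normc := (@Normc.normc R).
Implicit Type K : 'M[R[i]]_2.

Lemma ord2P (i : 'I_2) : i = 0 \/ i = 1.
Proof. by case: i => -[|[|//]] lti; [left|right]; exact: val_inj. Qed.

Lemma hnorm2E (v : 'cV[R[i]]_2) :
  hnorm v = normc (normc (v 0 0) +i* normc (v 1 0))%C.
Proof.
rewrite /hnorm !big_ord_recl big_ord0 addr0.
by rewrite (_ : lift ord0 ord0 = 1)//; exact: val_inj.
Qed.

Lemma le_hnorm2 (v : 'cV[R[i]]_2) j : normc (v j 0) <= hnorm v.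
Proof.
rewrite /hnorm -[leLHS]ger0_norm ?normc_ge0// -sqrtr_sqr ler_wsqrtr//.
by rewrite (bigD1 j)//= lerDl; apply: sumr_ge0 => i _; exact: sqr_ge0.
Qed.

(** [K i j] is a coordinate of the image of a unit vector. The crude bound [nK] by the sum of the
    entries shows that the supremum is over a bounded set. *)
Lemma normc_le_opnorm K i j : normc (K i j) <= opnorm K.
Proof.
pose e : 'cV[R[i]]_2 := delta_mx j 0.
have -> : K i j = (K *m e) i 0.
  rewrite mxE (bigD1 j)//= mxE !eqxx mulr1 big1 ?addr0// => k kj.
  by rewrite mxE (negbTE kj) mulr0.
apply: le_trans (le_hnorm2 _ i) _.
have nK v : hnorm v <= 1 ->
    hnorm (K *m v) <= (normc (K 0 0) + normc (K 0 1)) + (normc (K 1 0) + normc (K 1 1)).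
  move=> v1; have vj k : normc (v k 0) <= 1 by exact: le_trans (le_hnorm2 _ _) v1.
  rewrite hnorm2E (le_trans (normc_le _ _))// !ger0_norm ?normc_ge0//.
  have row k : normc ((K *m v) k 0) <= normc (K k 0) + normc (K k 1).
    rewrite mxE !big_ord_recl big_ord0 addr0 (_ : lift ord0 ord0 = 1); last exact: val_inj.
    rewrite (le_trans (@le_normcD R _ _))// !Normc.normcM.
    by apply: lerD; rewrite ler_piMr ?normc_ge0.
  exact: lerD (row 0) (row 1).
apply: ub_le_sup; first by eexists => _ [v v1 <-]; exact: nK v1.
exists e => //=; rewrite hnorm2E /e !mxE eqxx !andbT.
rewrite (le_trans (normc_le _ _))// !ger0_norm ?normc_ge0//.
have n01 (c : bool) : normc c%:R = c%:R.
  by case: c; [exact: Normc.normc1|exact: Normc.normc0].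
by rewrite !n01; have [->|->] := ord2P j; rewrite /= ?addr0 ?add0r.
Qed.

End hermitian.

(** * The boundary conditions in coordinates *)

Section boundary_conditions.
Context {R : realType}.
Variables (a b : R) (p Q : R -> R).
Local Notation D1 := (D1 a b p Q).
Local Notation Dom_Lmax := (Dom_Lmax a b p Q).
Implicit Types (K : 'M[R[i]]_2) (y : R -> R[i]).

Lemma Dom_LKP K y : Dom_LK a b p Q K y <-> [/\ Dom_Lmax y,
  (K 0 0 - 1) * D1 y a - K 0 1 * D1 y b + 'i%C * ((K 0 0 + 1) * y a + K 0 1 * y b) = 0 &
  K 1 0 * D1 y a - (K 1 1 - 1) * D1 y b + 'i%C * (K 1 0 * y a + (K 1 1 + 1) * y b) = 0].
Proof.
have E (i : 'I_2) : ((K - 1%:M) *m Gamma1 a b p Q y +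
      'i%C *: ((K + 1%:M) *m Gamma2 a b y)) i 0 =
    (K i 0 - (i == 0)%:R) * D1 y a - (K i 1 - (i == 1)%:R) * D1 y b +
    'i%C * ((K i 0 + (i == 0)%:R) * y a + (K i 1 + (i == 1)%:R) * y b).
  rewrite !mxE !big_ord_recl !big_ord0 !mxE /=.
  rewrite (_ : lift ord0 ord0 = 1); last exact: val_inj.
  by rewrite !addr0 mulrN.
split=> [[Dy /matrixP KE]|[Dy E0 E1]].
  have := KE 0 0; have := KE 1 0; rewrite !E !mxE/= !(subr0, addr0) => e1 e0.
  by split.
split=> //; apply/matrixP => i j; rewrite (ord1 j) E mxE.
have [->|->] := ord2P i; [rewrite -[RHS]E0|rewrite -[RHS]E1];
  by rewrite /= !(subr0, addr0).
Qed.

End boundary_conditions.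

(** * Separated conditions correspond to diagonal matrices *)

Local Open Scope complex_scope.

Theorem theorem7 (R : realType) (a b : R) (hab : a < b) (p Q : R -> R)
  (hp : Lebesgue_measurable `]a, b[%classic p)
  (hQ : Lebesgue_measurable `]a, b[%classic Q)
  (hp0 : {ae @lebesgue_measure R, forall x, `]a, b[%classic x -> p x != 0})
  (h1 : in_L1 `]a, b[%classic (fun x => 1 / p x))
  (h2 : in_L1 `]a, b[%classic (fun x => Q x / p x))
  (h3 : in_L1 `]a, b[%classic (fun x => Q x ^+ 2 / p x))
  (K : 'M[R[i]]_2) (hK : opnorm K <= 1) :
  separated_bc a b p Q (Dom_LK a b p Q K) <->
  exists Ka Kb : R[i],
    [/\ `|Ka| <= 1, `|Kb| <= 1 &
        K = diag_mx (\row_(k < 2) [:: Ka; Kb]`_k)].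
Proof.
split.
  move=> sep.
  (* For every [w], [Gamma1 y = - i (K + 1) w] and [Gamma2 y = (K - 1) w] satisfy
     the boundary conditions; the interpolation below is for [w = (1, 1)]. *)
  pose S0 := K 0 0 + K 0 1; pose S1 := K 1 0 + K 1 1.
  have [y [g [h [[Dy Dg Dh] [[ga gb ha hb] [[ya y'a yb y'b] [[ga' g'a gb' g'b]
    [ha' h'a hb' h'b]]]]]]]] := interpolation hab hp0 h1 h2 h3
      (S0 - 1) (- 'i%C * (S0 + 1)) (S1 - 1) ('i%C * (S1 + 1)).
  have Ly : Dom_LK a b p Q K y.
    by apply/Dom_LKP; rewrite ya y'a yb y'b /S0 /S1; split=> //; ring.
  have [/Dom_LKP [_ _ eg] /Dom_LKP [_ eh _]] := sep y g h Ly Dg Dh ga gb ha hb.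
  rewrite ga' g'a gb' g'b in eg; rewrite ha' h'a hb' h'b in eh.
  have i2 : 2 * 'i%C != 0 :> R[i].
    by rewrite mulf_neq0 ?pnatr_eq0// eq_complex /= oner_eq0 andbF.
  (* As [g] vanishes near [b], its second condition reduces to [K 1 0 * (D1 g a + i g a) = 0], where
     the bracket equals [- 2 i]; likewise the first condition for [h] gives [K 0 1 = 0]. *)
  have K10 : K 1 0 = 0.
    apply: (mulfI i2); rewrite mulr0 -[RHS]oppr0 -eg; ring.
  have K01 : K 0 1 = 0.
    apply: (mulfI i2); rewrite mulr0 -[RHS]oppr0 -eh; ring.
  have Kle j : `|K j j| <= 1.
    by rewrite -[`|_|]/((Normc.normc (K j j))%:C) lecR (le_trans (normc_le_opnorm _ _ _)).
  exists (K 0 0), (K 1 1); split=> //.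
  apply/matrixP => i j; rewrite !mxE.
  by have [->|->] := ord2P i; have [->|->] := ord2P j; rewrite ?K10 ?K01.
move=> [Ka [Kb [_ _ KE]]] y g h.
have K00 : K 0 0 = Ka by rewrite KE !mxE eqxx.
have K11 : K 1 1 = Kb by rewrite KE !mxE eqxx.
have K01 : K 0 1 = 0 by rewrite KE !mxE.
have K10 : K 1 0 = 0 by rewrite KE !mxE.
(* The zero function belongs to the maximal domain with zero quasi-derivative, so a zero germ is
   compared with it by the same locality argument. *)
have [D0 D10] := cert_Dom hab (cert0 a b p Q) (cert0 a b p Q).
have local_a y1 y2 : Dom_Lmax a b p Q y1 -> Dom_Lmax a b p Q y2 ->
    same_germ a b a y1 y2 -> y1 a = y2 a /\ D1 a b p Q y1 a = D1 a b p Q y2 a.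
  move=> Dy1 Dy2 /(same_germ_left hab)[c /andP[ac cb] e].
  by apply: (D1_local _ ac cb Dy1 Dy2 e); rewrite // in_itv/= lexx ltW.
have local_b y1 y2 : Dom_Lmax a b p Q y1 -> Dom_Lmax a b p Q y2 ->
    same_germ a b b y1 y2 -> y1 b = y2 b /\ D1 a b p Q y1 b = D1 a b p Q y2 b.
  move=> Dy1 Dy2 /(same_germ_right hab)[c /andP[ac cb] e].
  by apply: (D1_local ac cb _ Dy1 Dy2 e); rewrite // in_itv/= lexx ltW.
move=> /Dom_LKP[Dy]; rewrite K00 K01 K10 K11 => ya yb Dg Dh ga gb ha hb.
have [gya gya'] := local_a _ _ Dg Dy ga.
have [gb0 gb0'] := local_b _ _ Dg D0 gb.
have [ha0 ha0'] := local_a _ _ Dh D0 ha.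
have [hyb hyb'] := local_b _ _ Dh Dy hb.
rewrite D10 ?in_itv/= ?lexx ?ltW// in gb0'.
rewrite D10 ?in_itv/= ?lexx ?ltW// in ha0'.
rewrite -[(0 +i* 0)%C]/(0 : R[i]) in gb0 gb0' ha0 ha0'.
split; apply/Dom_LKP; rewrite K00 K01 K10 K11; split=> //.
- by rewrite gya gya' -[RHS]ya; ring.
- by rewrite gb0 gb0'; ring.
- by rewrite ha0 ha0'; ring.
- by rewrite hyb hyb' -[RHS]yb; ring.
Qed.
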